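(* Let $\lambda,\mu\in[0,1]$ and let $\zeta$ and $\zeta_*$ be bounded random variables with values in $[-a,a]$ for some $a>0$. Assume that for all $(x,x_*,T,T_* )\in\mathcal D\times\mathcal D\times\mathbb R^+\times\mathbb R^+$ the noise intensity $\sigma(x,x_*,T,T_* )\ge 0$ satisfies $$\sigma(x,x_*,T,T_* )\le \frac1a\min\left\{T,\;T(1-\lambda)+\lambda T_*,\;T(1-\mu)+\mu T_*\right\},$$ and that the same condition holds for $\sigma(x_*,x,T_*,T)$ after exchanging $T$ and $T_*$, i.e. $$\sigma(x_*,x,T_*,T)\le \frac1a\min\left\{T_*,\;T_*(1-\lambda)+\lambda T,\;T_*(1-\mu)+\mu T\right\}.$$ Then the post-interaction temperatures $$T'=T-\lambda(T-T_* )\chi_{\mathcal F}(x,x_*,T,T_* )-\mu(T-T_* )\chi_{\mathcal F}(x_*,x,T_*,T)+\sigma(x,x_*,T,T_* )\,\zeta,$$ $$T_*'=T_*-\lambda(T_*-T)\chi_{\mathcal F}(x_*,x,T_*,T)-\mu(T_*-T)\chi_{\mathcal F}(x,x_*,T,T_* )+\sigma(x_*,x,T_*,T)\,\zeta_*$$ are non-negative for all admissible values of $\zeta,\zeta_*,T,T_*$ (that is, for all values $\zeta,\zeta_*\in[-a,a]$, all $T,T_*\in\mathbb R^+$, and all $x,x_*\in\mathcal D$).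
   Context: $\mathcal D\subseteq\mathbb R^d$, $d\ge1$, and $\mathcal F:\mathcal D\to\mathbb R$ is a continuous objective function. Temperatures are non-negative reals, $\mathbb R^+=[0,\infty)$. The interaction indicator is $$\chi_{\mathcal F}(x,x_*,T,T_* )=\Psi\big(\mathcal F(x)<\mathcal F(x_* )\big)\,\Psi(T_*<T),$$ where $\Psi(\cdot)$ equals $1$ if its argument is true and $0$ otherwise. The function $\sigma$ is the real-valued intensity of the noise in a binary temperature interaction between two particles $(x,T)$ and $(x_*,T_* )$; the random variables $\zeta,\zeta_*$ are assumed symmetric with mean zero. *)

(* Defs.v *)
From HB Require Import structures.
From mathcomp Require Import all_boot all_order all_algebra.
From mathcomp Require Import all_classical all_reals all_analysis.
Set Implicit Arguments.
Unset Strict Implicit.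
Unset Printing Implicit Defensive.
Import Order.TTheory GRing.Theory Num.Theory.
Import numFieldNormedType.Exports.
Local Open Scope classical_set_scope.
Local Open Scope ring_scope.

Definition indicator (R : realType) (b : bool) : R := if b then 1 else 0.
Arguments indicator R b : clear implicits.

Definition chi (R : realType) (X : Type) (F : X -> R) (x xs : X) (T Ts : R) : R :=
  indicator R (F x < F xs) * indicator R (Ts < T).

(* [z] is the realized noise value. The temperature of the second particle
   after the interaction is obtained by exchanging the roles of the particles:
   [post_temp F sigma lambda mu xs x Ts T zs]. *)
Definition post_temp (R : realType) (X : Type) (F : X -> R)
    (sigma : X -> X -> R -> R -> R) (lambda mu : R)
    (x xs : X) (T Ts z : R) : R :=
  T - lambda * (T - Ts) * chi F x xs T Ts
    - mu * (T - Ts) * chi F xs x Ts T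
    + sigma x xs T Ts * z.

Definition symmetric_RV (disp : measure_display) (Omega : measurableType disp)
    (R : realType) (P : probability Omega R) (zeta : {RV P >-> R}) : Prop :=
  forall A : set R, measurable A ->
    P (zeta @^-1` A) = P ((fun w => - zeta w) @^-1` A).

(* Main.v *)
Require Import Defs.
From mathcomp Require Import all_boot all_order all_algebra.
From mathcomp Require Import all_classical all_reals all_analysis.
From mathcomp Require Import lra.
Import Order.TTheory GRing.Theory Num.Theory.
Import numFieldNormedType.Exports.
Local Open Scope classical_set_scope.
Local Open Scope ring_scope.

(** The two relaxation terms are never active together: one needs
    [F x < F xs], the other [F xs < F x].  Hence, without noise, the temperature
    after the interaction is one of [T], [T * (1 - lambda) + lambda * Ts] and
    [T * (1 - mu) + mu * Ts], and so is at least the minimum [m] of the three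
    ([le_min_drift]).  The noise lowers it by at most [a] times the intensity,
    and the bound on the intensity says that this product is at most [m]
    ([noise_ge]).  The bounds are assumed for every pair of particles, so
    exchanging the two particles gives the second temperature, and realized
    noise values are particular numbers between [- a] and [a]. *)

(** The alternatives of the minimum in the intensity bound are exactly the
    values that the noiseless interaction can produce. *)
Lemma le_min_drift (R : realType) (X : Type) (F : X -> R) (lambda mu : R)
    (x xs : X) (T Ts : R) :
  Num.min T (Num.min (T * (1 - lambda) + lambda * Ts)
                     (T * (1 - mu) + mu * Ts)) <=
    T - lambda * (T - Ts) * chi F x xs T Ts - mu * (T - Ts) * chi F xs x Ts T.
Proof.
set m := Num.min _ _.
have [m1 m2 m3] : [/\ m <= T, m <= T * (1 - lambda) + lambda * Ts &
    m <= T * (1 - mu) + mu * Ts].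
  by rewrite /m !ge_min !lexx !orbT.
rewrite /chi /indicator.
by case: (ltgtP (F x) (F xs)) => _; case: (ltgtP Ts T) => _; lra.
Qed.

Lemma noise_ge (R : realType) (a s m z : R) :
  0 < a -> 0 <= s -> s <= 1 / a * m -> - a <= z -> - m <= s * z.
Proof.
move=> a_gt0 s_ge0; rewrite mul1r mulrC ler_pdivlMr// => sa_le z_ge.
by rewrite (le_trans _ (ler_wpM2l s_ge0 z_ge))// mulrN lerN2.
Qed.

Lemma post_temp_ge0 (R : realType) (X : Type) (F : X -> R)
    (sigma : X -> X -> R -> R -> R) (lambda mu a : R) (x xs : X) (T Ts z : R) :
  0 < a -> 0 <= sigma x xs T Ts ->
  sigma x xs T Ts <=
    1 / a * Num.min T (Num.min (T * (1 - lambda) + lambda * Ts)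
                               (T * (1 - mu) + mu * Ts)) ->
  - a <= z ->
  0 <= post_temp F sigma lambda mu x xs T Ts z.
Proof.
move=> a_gt0 s_ge0 s_le z_ge; rewrite /post_temp.
have := lerD (le_min_drift _ _ F lambda mu x xs T Ts)
               (noise_ge _ _ _ _ _ a_gt0 s_ge0 s_le z_ge).
by rewrite subrr.
Qed.

Theorem lemma2p1 (R : realType) (d : nat) (hd : (1 <= d)%N)
    (D : set 'rV[R]_d) (F : 'rV[R]_d -> R) (hF : {within D, continuous F})
    (disp : measure_display) (Omega : measurableType disp)
    (P : probability Omega R)
    (lambda mu : R) (hlambda : 0 <= lambda <= 1) (hmu : 0 <= mu <= 1)
    (a : R) (ha : 0 < a)
    (zeta zetas : {RV P >-> R})
    (hzeta : forall w : Omega, - a <= zeta w <= a)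
    (hzetas : forall w : Omega, - a <= zetas w <= a)
    (hsym : symmetric_RV zeta) (hsyms : symmetric_RV zetas)
    (hmean : ('E_P[zeta] = 0)%E) (hmeans : ('E_P[zetas] = 0)%E)
    (sigma : 'rV[R]_d -> 'rV[R]_d -> R -> R -> R)
    (hsigma_ge0 : forall (x xs : 'rV[R]_d) (T Ts : R),
       D x -> D xs -> 0 <= T -> 0 <= Ts -> 0 <= sigma x xs T Ts)
    (hsigma : forall (x xs : 'rV[R]_d) (T Ts : R),
       D x -> D xs -> 0 <= T -> 0 <= Ts ->
       sigma x xs T Ts <=
         1 / a * Num.min T (Num.min (T * (1 - lambda) + lambda * Ts)
                                    (T * (1 - mu) + mu * Ts)))
    (hsigmas : forall (x xs : 'rV[R]_d) (T Ts : R),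
       D x -> D xs -> 0 <= T -> 0 <= Ts ->
       sigma xs x Ts T <=
         1 / a * Num.min Ts (Num.min (Ts * (1 - lambda) + lambda * T)
                                     (Ts * (1 - mu) + mu * T))) :
  forall (x xs : 'rV[R]_d) (T Ts : R),
    D x -> D xs -> 0 <= T -> 0 <= Ts ->
    (forall z zs : R, - a <= z <= a -> - a <= zs <= a ->
       0 <= post_temp F sigma lambda mu x xs T Ts z /\
       0 <= post_temp F sigma lambda mu xs x Ts T zs) /\
    (forall w : Omega,
       0 <= post_temp F sigma lambda mu x xs T Ts (zeta w) /\
       0 <= post_temp F sigma lambda mu xs x Ts T (zetas w)).
Proof.
move=> x xs T Ts Dx Dxs T_ge0 Ts_ge0.
have nonneg z zs : - a <= z <= a -> - a <= zs <= a ->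
    0 <= post_temp F sigma lambda mu x xs T Ts z /\
    0 <= post_temp F sigma lambda mu xs x Ts T zs.
  move=> /andP[z_ge _] /andP[zs_ge _].
  split; apply: (post_temp_ge0 _ _ _ _ _ _ a) => //.
  - exact: hsigma_ge0.
  - exact: hsigma.
  - exact: hsigma_ge0.
  - exact: hsigma.
by split=> [//|w]; apply: nonneg.
Qed.
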